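(* Let $S\ge2$ be a fixed integer and let $0<x<1$ be fixed. For integers $R\ge 2$ put $N=SR$, and let $X_n$ be the number of pairs in $n$ cards selected uniformly at random from the generalized deck with $S$ suits and $R$ ranks. In the limit $R\to\infty$ and $n\to\infty$ with $n/N=x$ held fixed (i.e. along integers $R\to\infty$ for which $n=xSR$ is an integer), $$\frac{E[X_n]}{R}\to \frac{S}{2}x-\frac14+\frac{(1-2x)^S}{4}$$ and $$\frac{V[X_n]}{R}\to \frac1{16}+\frac{S-1}{16}(1-2x)^{2S}-\frac{S}{16}(1-2x)^{2S-2}.$$
   Context: Generalized deck: a set of $N=SR$ distinct cards, one for each (suit, rank) combination, with $S$ suits and $R$ ranks; thus each rank occurs on exactly $S$ cards. A set of $n$ cards is selected uniformly at random among all $n$-element subsets of the deck. A pair is a set of two cards of the same rank. The number of pairs in a set of cards is the maximum number of pairwise disjoint pairs it contains; i.e. if the set contains $y_i$ cards of rank $i$ for $i=1,\dots,R$, the number of pairs is $\sum_{i=1}^R\lfloor y_i/2\rfloor$ (e.g. four cards of one rank count as two pairs, three cards of one rank as one pair). $X_n$ is the number of pairs in the random set of $n$ cards; $E$ and $V$ denote expectation and variance. *)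

(* Defs.v *)
From HB Require Import structures.
From mathcomp Require Import all_boot all_order all_algebra.
From mathcomp Require Import all_classical all_reals all_analysis.

Set Implicit Arguments.
Unset Strict Implicit.
Unset Printing Implicit Defensive.

Import Order.TTheory GRing.Theory Num.Theory.
Import numFieldNormedType.Exports.

Local Open Scope ring_scope.

(* A card is a (suit, rank) combination. *)
Definition deck (s r : nat) : Type := 'I_s * 'I_r.

HB.instance Definition _ (s r : nat) := Finite.on (deck s r).

Definition card_rank (s r : nat) (c : deck s r) : 'I_r := c.2.

Definition is_pair (s r : nat) (B : {set deck s r}) : bool :=
  (#|B| == 2) && [forall c in B, forall c' in B, card_rank c == card_rank c'].

Definition num_pairs (s r : nat) (A : {set deck s r}) : nat :=
  \max_(F : {set {set deck s r}} |
     [&& finset.trivIset F,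
         [forall B in F, is_pair B] & [forall B in F, B \subset A]]) #|F|.

(* The sample space consists of all the subsets of the deck, with the discrete
   sigma-algebra; the law [draw] below is carried by the n-element ones. *)
Definition hand (s r : nat) : Type := {set deck s r}.

HB.instance Definition _ (s r : nat) := Finite.on (hand s r).
HB.instance Definition _ (s r : nat) :=
  isPointed.Build (hand s r) (finset.set0 : {set deck s r}).
HB.instance Definition _ (s r : nat) :=
  @isMeasurable.Build default_measure_display (hand s r)
    discrete_measurable discrete_measurable0
    discrete_measurableC discrete_measurableU.

Definition hands (s r n : nat) : set (hand s r) :=
  [set A : hand s r | #|(A : {set deck s r})| = n]%classic.
Arguments hands s r n : clear implicits.

Lemma measurable_hands (s r n : nat) : measurable (hands s r n).
Proof. by []. Qed.
Arguments measurable_hands s r n : clear implicits.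

(* The normalized counting measure on the n-element sets of cards. The second
   argument of [mnormalize] is a default, used only when there is no such set,
   that is, when n > s * r. *)
Definition draw (R : realType) (s r n : nat) : probability (hand s r) R :=
  mnormalize (mrestr (@counting (hand s r) R) (measurable_hands s r n))
             (@dirac _ (hand s r) point R).
Arguments draw R s r n : clear implicits.

Definition X (R : realType) (s r : nat) (A : hand s r) : R :=
  (num_pairs A)%:R.
Arguments X R s r A : clear implicits.

(* The pairs (r, n) with r -> oo and n -> oo along n / (s * r) = x. If x is
   irrational there is no such pair and this filter is improper. *)
Definition fixed_ratio (R : realType) (s : nat) (x : R) :
    set_system (nat * nat) :=
  within [set p : nat * nat |
           (2 <= p.1)%N /\ p.2%:R / (s * p.1)%:R = x]%classic
         (filter_prod \oo \oo)%classic.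

(* Main.v *)
Require Import Defs.
From HB Require Import structures.
From mathcomp Require Import all_boot all_order all_algebra.
From mathcomp Require Import all_classical all_reals all_analysis.
From mathcomp Require Import finmap ring lra zify.

(** Write y_i for the number of drawn cards of rank i. Since
      floor (y / 2) = y / 2 - 1 / 4 + (-1)^y / 4,
    the number of pairs is an affine function of a sum of signs,
      X_n = n / 2 - r / 4 + (1 / 4) sum_i chi_i   with  chi_i = (-1)^(y_i),
    so that both moments of X_n are carried by the means of the characters
    chi_K (A) = (-1)^|A cap K| of the group of subsets, for K a set of s cards
    (one rank) and for K a set of 2 s cards (two ranks, since
    chi_K chi_L = chi_(K cup L) for disjoint K and L).

    The mean W_k of chi_K over the n-element sets A depends only on k = |K|: it
    is a coefficient of the product of (1 - t)^k and (1 + t)^(N - k), divided by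
    a binomial coefficient. Moving one card in or out of K multiplies chi_K (A)
    by -1 or 1 according to whether A contains that card; summing over all the
    cards and averaging over A gives the three-term recurrence
      (N - k) W_(k+1) + k W_(k-1) = (N - 2 n) W_k = N u W_k,   u = 1 - 2 n / N.
    When n / N = x, the number u = 1 - 2 x is fixed, W_k depends on N alone, and
    the recurrence yields, by induction on k,
      W_k -> u^k   and   N (W_k - u^k) -> - binom(k, 2) (1 - u^2) u^(k-2)
    ([cvg_krawtchouk_mean], [cvg_krawtchouk_mean_defect]).

    The first limit gives the expectation. For the variance,
      V[X_n] / r = (1 + (r - 1) W_(2s) - r W_s^2) / 16
    ([average_X_variance]): the r (r - 1) covariances are of order 1 / N each,
    so their contribution is of the same order as that of the r variances, and
    the second limit evaluates it ([cvg_krawtchouk_mean_cov]). *)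

Set Implicit Arguments.
Unset Strict Implicit.
Unset Printing Implicit Defensive.

Import Order.TTheory GRing.Theory Num.Theory.
Import numFieldNormedType.Exports.

Local Open Scope ring_scope.

(** * Means of characters over the subsets of a given size *)

Section Characters.
Variables (R : numFieldType) (T : finType).
Implicit Types (A K L : {set T}) (f g : {set T} -> R).

Definition character K A : R := (-1) ^+ #|A :&: K|.

Definition average n f : R :=
  (\sum_(A : {set T} | #|A| == n) f A) / 'C(#|T|, n)%:R.

Lemma averageD n f g :
  average n (fun A => f A + g A) = average n f + average n g.
Proof. by rewrite /average big_split mulrDl. Qed.

Lemma averageZ n a f : average n (fun A => a * f A) = a * average n f.
Proof. by rewrite /average -mulr_sumr mulrA. Qed.

Lemma average_sum (I : finType) (P : pred I) n (F : I -> {set T} -> R) :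
  average n (fun A => \sum_(i | P i) F i A) = \sum_(i | P i) average n (F i).
Proof. by rewrite /average exchange_big mulr_suml. Qed.

Lemma eq_average n f g :
  (forall A, #|A| = n -> f A = g A) -> average n f = average n g.
Proof.
by move=> fg; rewrite /average; congr (_ / _); apply: eq_bigr => A /eqP/fg.
Qed.

Lemma average_cst n (a : R) : (n <= #|T|)%N -> average n (fun=> a) = a.
Proof.
move=> nT; rewrite /average sumr_const.
have -> : #|[pred A : {set T} | #|A| == n]| = 'C(#|T|, n).
  by rewrite -card_draws cardsE; apply: eq_card => A; rewrite !inE.
by rewrite -[a *+ _]mulr_natr mulfK // pnatr_eq0 -lt0n bin_gt0.
Qed.

Lemma character0 : character finset.set0 = fun=> 1.
Proof. by apply/funext => A; rewrite /character finset.setI0 cards0 expr0. Qed.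

Lemma characterU1 c K A : c \notin K ->
  character (c |: K) A = (-1) ^+ (c \in A) * character K A.
Proof.
move=> cK; rewrite /character -exprD; congr (_ ^+ _).
rewrite (cardsD1 c) !inE eqxx /= andbT; congr (_ + _)%N.
apply: eq_card => d; rewrite !inE.
by case: eqVneq => //= ->; rewrite (negPf cK) andbF.
Qed.

Lemma characterU K L A : [disjoint K & L] ->
  character (K :|: L) A = character K A * character L A.
Proof.
move=> KL; rewrite /character -exprD finset.setIUr cardsU.
rewrite [X in (_ - X)%N](_ : _ = 0%N) ?subn0 //; apply: eq_card0 => c.
by rewrite !inE; case: (boolP (c \in K)) => cK; rewrite ?andbF // (disjointFr KL cK) !andbF.
Qed.

Lemma character_sqr K A : character K A * character K A = 1.
Proof. by rewrite /character -expr2 sqrr_sign. Qed.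

(** Both sides expand the product over all c of 1 + t or 1 - t, the sign being
    minus for c in K. In particular the sum depends on K through #|K| only. *)
Lemma sum_character_coef n K :
  \sum_(A : {set T} | #|A| == n) character K A =
  ((1 - 'X) ^+ #|K| * (1 + 'X) ^+ (#|T| - #|K|))`_n.
Proof.
have -> : (1 - 'X) ^+ #|K| * (1 + 'X) ^+ (#|T| - #|K|) =
    \prod_(c : T) ((-1) ^+ (c \in K) * 'X + 1 : {poly R}).
  rewrite (bigID (mem K)) /=; congr (_ * _).
    rewrite (eq_bigr (fun=> 1 - 'X)) ?prodr_const // => c ->.
    by rewrite expr1 mulN1r addrC.
  rewrite (eq_bigr (fun=> 1 + 'X)) => [|c /negPf->]; last by rewrite mul1r addrC.
  rewrite prodr_const; congr (_ ^+ _).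
  by rewrite -(cardC K) addKn.
rewrite bigA_distr.
have mono A : \prod_c (if c \in A then (-1) ^+ (c \in K) * 'X else 1) =
    (character K A)%:P * 'X^#|A| :> {poly R}.
  rewrite -big_mkcond big_split prodr_const; congr (_ * _).
  rewrite prodrXr /character rmorphXn rmorphN1; congr (_ ^+ _).
  by rewrite -sum1dep_card big_mkcondr /=; apply: eq_bigr => c _; case: (c \in K).
rewrite (eq_bigr (fun A => (character K A)%:P * 'X^#|A|)) => [|A _]; last exact: mono.
rewrite coef_sum [RHS](bigID (fun A : {set T} => #|A| == n)) /=.
rewrite [X in _ = _ + X]big1 ?addr0 => [|A /negPf An]; last first.
  by rewrite coefCM coefXn eq_sym An mulr0.
by apply: eq_bigr => A /eqP An; rewrite coefCM coefXn An eqxx mulr1.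
Qed.

Lemma average_character_card n K L :
  #|K| = #|L| -> average n (character K) = average n (character L).
Proof. by rewrite /average !sum_character_coef => ->. Qed.

(** Moving c in or out of K multiplies the character by -1 if c is in A and by 1
    otherwise, and these signs add up to the difference between the sizes of
    the complement of A and of A. *)
Lemma sum_character_flip K A :
  \sum_(c | c \notin K) character (c |: K) A +
  \sum_(c in K) character (K :\ c) A =
  (#|T|%:R - 2 * #|A|%:R) * character K A.
Proof.
have -> : #|T|%:R - 2 * #|A|%:R = \sum_c (-1) ^+ (c \in A) :> R.
  rewrite (bigID (mem A)) /= (eq_bigr (fun=> -1)) ?sumr_const; last first.
    by move=> c ->.
  rewrite (eq_bigr (fun=> 1)) ?sumr_const; last by move=> c /negPf->.
  by rewrite -(cardC A) natrD mulNrn; ring.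
rewrite mulr_suml [RHS](bigID (mem K)) /= [LHS]addrC; congr (_ + _).
  apply: eq_bigr => c cK; rewrite -{2}(finset.setD1K cK) characterU1 ?setD11 //.
  by rewrite mulrA -expr2 sqrr_sign mul1r.
by apply: eq_bigr => c cK; rewrite characterU1.
Qed.

End Characters.

(** The value K_n(k) / binom(N, n) of the binary Krawtchouk polynomial of degree
    n, normalized to be 1 at k = 0. It is given by the recurrence in k, in which
    n enters only through u = 1 - 2 n / N, so that N can tend to infinity with u
    fixed. *)
Fixpoint krawtchouk_mean (R : fieldType) (u : R) (N k : nat) : R :=
  match k with
  | 0 => 1
  | k1.+1 =>
    if k1 is k2.+1 then
      (N%:R * u * krawtchouk_mean u N k1 - k1%:R * krawtchouk_mean u N k2)
        / (N%:R - k1%:R)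
    else u
  end.
Arguments krawtchouk_mean : simpl never.

Lemma krawtchouk_meanSS (R : fieldType) (u : R) N k :
  krawtchouk_mean u N k.+2 =
  (N%:R * u * krawtchouk_mean u N k.+1 - k.+1%:R * krawtchouk_mean u N k)
    / (N%:R - k.+1%:R).
Proof. by []. Qed.

(** Averaging [sum_character_flip] over A expresses the mean for a set of size
    k + 1 by the means for sizes k and k - 1. *)
Lemma average_character (R : numFieldType) (T : finType) (u : R) n
    (K : {set T}) :
  (n <= #|T|)%N -> #|T|%:R * u = #|T|%:R - 2 * n%:R ->
  average n (character R K) = krawtchouk_mean u #|T| #|K|.
Proof.
move=> nT uE.
have avg0 : average n (character R (finset.set0 : {set T})) = 1.
  by rewrite character0 average_cst.
pose w k := krawtchouk_mean u #|T| k.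
(* All the sets d |: L have the same size, hence equal means: the first sum of
   the flip identity is replaced by N - #|L| copies of one term. *)
have step (L : {set T}) c : c \notin L ->
    (#|T|%:R - #|L|%:R) * average n (character R (c |: L)) +
      \sum_(d in L) average n (character R (L :\ d)) =
    #|T|%:R * u * average n (character R L).
  move=> cL; rewrite uE -averageZ.
  rewrite [RHS](eq_average (g := fun A => \sum_(d | d \notin L) character R (d |: L) A +
    \sum_(d in L) character R (L :\ d) A)); last first.
    by move=> A An; rewrite sum_character_flip An.
  rewrite averageD !average_sum; congr (_ + _).
  rewrite (eq_bigr (fun=> average n (character R (c |: L)))) => [|d dL].
    rewrite sumr_const -[RHS]mulr_natl; congr (_ * _).
    by rewrite -(cardC L) natrD addrAC subrr add0r.
  by apply: average_character_card; rewrite !cardsU1 cL dL.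
have [m] := ubnP #|K|; elim: m => // m IHm in K *.
case: (set_0Vmem K) => [-> _|[c cK]]; first by rewrite cards0 avg0.
rewrite (cardsD1 c) cK add1n ltnS => Km.
have := step _ c (negbT (setD11 c K)); rewrite (finset.setD1K cK).
have N0 : (#|K :\ c| < #|T|)%N.
  by apply: leq_trans (max_card (mem K)); rewrite (cardsD1 c K) cK.
have NK : (#|T|%:R - #|K :\ c|%:R : R) != 0 by rewrite subr_eq0 eqr_nat gtn_eqF.
rewrite (IHm _ Km).
rewrite (eq_bigr (fun=> w #|K :\ c|.-1)) => [|d dK]; last first.
  have e : #|K :\ c| = #|(K :\ c) :\ d|.+1 by rewrite (cardsD1 d) dK.
  by rewrite IHm; [rewrite e|move: Km; rewrite e => /ltnW].
rewrite sumr_const -[w _ *+ _]mulr_natl /w.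
case: #|K :\ c| NK => [|k] NK /= e; apply: (mulfI NK).
  by move: e; rewrite mul0r addr0 mulr1 subr0.
by rewrite [RHS]mulrC divfK // -e addrK.
Qed.

(** * The number of pairs, rank by rank *)

Section Pairs.
Variables (s r : nat).
Local Notation deck := (deck s r).
Implicit Types (A B : {set deck}) (F : {set {set deck}}).

Definition rank_class (i : 'I_r) : {set deck} := [set c | card_rank c == i]%SET.

Definition pairing A F :=
  [&& finset.trivIset F, [forall B in F, is_pair B] & [forall B in F, B \subset A]].

Lemma card_rank_class i : #|rank_class i| = s.
Proof.
rewrite -[RHS]card_ord -(card_imset _ (f := fun a : 'I_s => (a, i) : deck)).
  apply: eq_card => -[a j]; rewrite !inE /card_rank /=.
  by apply/eqP/imsetP => [->|[b _ [_ ->]]] //; exists a.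
by move=> a b [].
Qed.

Lemma disjoint_rank_class i j : i != j -> [disjoint rank_class i & rank_class j].
Proof.
move=> ij; rewrite disjoint_subset; apply/fintype.subsetP => c; rewrite !inE.
by move=> /eqP->.
Qed.

Lemma sum_card_rank_class A : (\sum_i #|A :&: rank_class i|)%N = #|A|.
Proof.
rewrite -sum1_card (partition_big (@card_rank s r) predT) //=.
apply: eq_bigr => i _; rewrite -sum1_card; apply: eq_bigl => c.
by rewrite !inE.
Qed.

(** Every pair lies inside one rank, and the disjoint pairs of a family that lie
    in rank i cover twice as many cards of A of that rank. *)
Lemma pairing_card A F : pairing A F ->
  (#|F| <= \sum_i (#|A :&: rank_class i|)./2)%N.
Proof.
move=> /and3P[tF /forall_inP pF /forall_inP sF].
have Fi (i : 'I_r) : (#|[set B in F | B \subset rank_class i]%SET| <=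
    (#|A :&: rank_class i|)./2)%N.
  set G := [set B in F | B \subset _]%SET.
  have GF : G \subset F by apply/fintype.subsetP => B; rewrite inE => /andP[].
  rewrite geq_half_double -muln2 -sum_nat_const.
  rewrite (eq_bigr (fun B => #|B|)) => [|B /(fintype.subsetP GF)/pF/andP[/eqP->]//].
  move: (finset.trivIsetS GF tF); rewrite /finset.trivIset => /eqP->.
  apply/subset_leq_card/fintype.subsetP => c /bigcupP[B].
  rewrite inE => /andP[/sF/fintype.subsetP BA /fintype.subsetP Bi] cB.
  by rewrite inE BA ?Bi.
apply: (@leq_trans (\sum_i #|[set B in F | B \subset rank_class i]%SET|)%N);
  last by apply: leq_sum => i _; exact: Fi.
rewrite -sum1_card.
under [leqRHS]eq_bigr => i _ do rewrite -sum1_card big_mkcond.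
rewrite exchange_big /= big_mkcond; apply: leq_sum => B _.
case: ifP => // BF.
have /andP[/eqP B2 /forall_inP Br] := pF _ BF.
have /set0Pn[c cB] : B != finset.set0 by rewrite -card_gt0 B2.
rewrite (bigD1 (card_rank c)) //= inE BF /= (_ : B \subset _) //.
apply/fintype.subsetP => d dB; rewrite inE.
by have /forall_inP := Br _ dB; apply.
Qed.

(** Greedy choice: as long as some rank has two cards in A, remove two such cards;
    this lowers the sum of the halves by exactly one. *)
Lemma exists_pairing A :
  exists2 F, pairing A F & #|F| = (\sum_i (#|A :&: rank_class i|)./2)%N.
Proof.
have [m] := ubnP #|A|; elim: m => // m IHm in A *; rewrite ltnS => Am.
have [/existsP[i]|] := boolP [exists i, 1 < #|A :&: rank_class i|]%N; last first.
  rewrite negb_exists => /forallP A1; exists finset.set0.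
    apply/and3P; split; last 2 first.
    - by apply/forall_inP => B; rewrite inE.
    - by apply/forall_inP => B; rewrite inE.
    - by rewrite /finset.trivIset /finset.cover !finset.big_set0 cards0.
  rewrite cards0 big1 // => i _; have := A1 i; rewrite -leqNgt.
  by case: #|_| => [|[]].
case/card_gt1P => c [d [+ + cd]]; rewrite !inE => /andP[cA ci] /andP[dA di].
pose P : {set deck} := [set c; d]%SET.
have PA : P \subset A by rewrite finset.subUset !finset.sub1set cA.
have Pi : P \subset rank_class i by rewrite finset.subUset !finset.sub1set !inE ci.
have P2 : #|P| = 2 by rewrite cards2 cd.
have AP : #|A :\: P|.+2 = #|A|.
  by rewrite -(cardsID P A) (finset.setIidPr PA) P2.
have [|F /and3P[tF /forall_inP pF /forall_inP sF] cF] := IHm (A :\: P).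
  by apply: leq_trans Am; rewrite -AP.
have PF : P \notin F.
  apply/negP => /sF/fintype.subsetP/(_ c); rewrite !inE eqxx /=.
  by move/(_ isT).
have dP B : B \in F -> [disjoint P & B].
  move=> /sF/fintype.subsetP BA; rewrite disjoint_sym disjoint_subset.
  by apply/fintype.subsetP => e /BA; rewrite !inE => /andP[].
exists (P |: F).
  apply/and3P; split.
  - apply/finset.trivIsetP => B C /setU1P[->|BF] /setU1P[->|CF] BC.
    + by rewrite eqxx in BC.
    + exact: dP.
    + by rewrite disjoint_sym dP.
    + exact: (finset.trivIsetP tF).
  - apply/forall_inP => B /setU1P[->|/pF//]; rewrite /is_pair P2 eqxx /=.
    apply/forall_inP => a /(fintype.subsetP Pi); rewrite inE => /eqP->.
    by apply/forall_inP => b /(fintype.subsetP Pi); rewrite inE eq_sym.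
  - apply/forall_inP => B /setU1P[->//|/sF BA].
    exact: fintype.subset_trans BA (finset.subsetDl _ _).
rewrite cardsU1 PF cF (bigD1 i) //= [RHS](bigD1 i) //= addnA; congr (_ + _)%N.
  have -> : #|A :&: rank_class i| = #|(A :\: P) :&: rank_class i|.+2.
    rewrite -(cardsID P (A :&: rank_class i)) finset.setIDAC -finset.setIA.
    by rewrite (finset.setIidPr Pi) (finset.setIidPr PA) P2.
  by [].
apply: eq_bigr => j ji; congr (_./2); apply: eq_card => e; rewrite !inE.
case: (eqVneq (card_rank e) j) => [ej|]; rewrite ?andbF // !andbT.
case: (e \in A); rewrite ?andbF // andbT; apply/norP; split; apply/eqP => ee.
  by rewrite -ej ee ci in ji.
by rewrite -ej ee di in ji.
Qed.

Lemma num_pairsE A : num_pairs A = (\sum_i (#|A :&: rank_class i|)./2)%N.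
Proof.
apply/eqP; rewrite eqn_leq; apply/andP; split.
  by apply/bigmax_leqP => F; apply: pairing_card.
have [F pF <-] := exists_pairing A.
exact: (@leq_bigmax_cond _ (pairing A) (fun F : {set {set deck}} => #|F|)).
Qed.

End Pairs.

(** * Asymptotics of the means of characters *)

Local Open Scope classical_set_scope.

Lemma cvg_inv_subn (R : realType) (k : nat) :
  ((N%:R - k%:R)^-1 : R) @[N --> \oo] --> (0 : R).
Proof.
rewrite -(cvg_shiftn k.+1) /=; have := @cvg_harmonic R.
suff -> : harmonic = fun N => ((N + k.+1)%:R - k%:R)^-1 :> R by [].
apply/funext => N; by rewrite /harmonic addnS -addSn natrD addrK.
Qed.

Lemma cvg_addn_inv_subn (R : realType) (k : nat) :
  (1 + k%:R * (N%:R - k%:R)^-1 : R) @[N --> \oo] --> (1 : R).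
Proof.
have := cvgD (cvg_cst (1 : R)) (cvgM (cvg_cst (k%:R : R)) (@cvg_inv_subn R k)).
by rewrite mulr0 addr0; apply.
Qed.

Lemma near_subn_neq0 (R : realType) (k : nat) :
  \forall N \near \oo, (N%:R - k%:R : R) != 0.
Proof.
by exists k.+1 => // N /= kN; rewrite subr_eq0 eqr_nat gtn_eqF.
Qed.

(** As N grows, the recurrence tends to W_(k+2) = u W_(k+1). *)
Lemma cvg_krawtchouk_mean (R : realType) (u : R) (k : nat) :
  krawtchouk_mean u N k @[N --> \oo] --> u ^+ k.
Proof.
suff: krawtchouk_mean u N k @[N --> \oo] --> u ^+ k /\
  krawtchouk_mean u N k.+1 @[N --> \oo] --> u ^+ k.+1 by case.
elim: k => [|k [IH0 IH1]]; first by split; exact: cvg_cst.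
split=> //.
have cC : (k.+1%:R * (N%:R - k.+1%:R)^-1 : R) @[N --> \oo] --> (0 : R).
  by rewrite -[X in _ --> X](mulr0 k.+1%:R);
    exact: cvgM (cvg_cst _) (@cvg_inv_subn R k.+1).
have -> : u ^+ k.+2 = 1 * (u * u ^+ k.+1) - 0 * u ^+ k.
  by rewrite mul0r subr0 mul1r -exprS.
apply: cvg_trans; last exact: (cvgB
  (cvgM (@cvg_addn_inv_subn R k.+1) (cvgM (cvg_cst u) IH1)) (cvgM cC IH0)).
apply: near_eq_cvg; near=> N.
have N0 : (N%:R - k.+1%:R : R) != 0 by near: N; exact: near_subn_neq0.
rewrite krawtchouk_meanSS !fctE /=.
move: (k.+1%:R : R) (N%:R : R) N0 => a b ab0.
by field.
Unshelve. all: by end_near. Qed.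

(** Multiplying the recurrence by N, the limit c_k of the scaled defect
    N (W_k - u^k) satisfies c_(k+1) = u c_k - k (1 - u^2) u^(k-1), whose solution
    with c_0 = c_1 = 0 comes from Pascal's rule for binom(k, 2). For k < 2 the
    truncated exponent k - 2 is harmless because the binomial vanishes. *)
Lemma cvg_krawtchouk_mean_defect (R : realType) (u : R) (k : nat) :
  N%:R * (krawtchouk_mean u N k - u ^+ k) @[N --> \oo] -->
  - 'C(k, 2)%:R * (1 - u ^+ 2) * u ^+ (k - 2).
Proof.
suff: N%:R * (krawtchouk_mean u N k - u ^+ k) @[N --> \oo] -->
    - 'C(k, 2)%:R * (1 - u ^+ 2) * u ^+ (k - 2) /\
  N%:R * (krawtchouk_mean u N k.+1 - u ^+ k.+1) @[N --> \oo] -->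
    - 'C(k.+1, 2)%:R * (1 - u ^+ 2) * u ^+ (k.+1 - 2) by case.
elim: k => [|k [IH0 IH1]].
  split; rewrite oppr0 !mul0r; under eq_fun do rewrite subrr mulr0;
  exact: cvg_cst.
split=> //.
have -> : - 'C(k.+2, 2)%:R * (1 - u ^+ 2) * u ^+ (k.+2 - 2) =
  1 * (u * (- 'C(k.+1, 2)%:R * (1 - u ^+ 2) * u ^+ (k.+1 - 2)) -
    k.+1%:R * u ^+ k + k.+1%:R * u ^+ k.+2).
  rewrite mul1r binS bin1 natrD.
  case: k {IH0 IH1} => [|k]; first by rewrite bin_small // !expr0; ring.
  by rewrite !subSS !subn0 !exprS; ring.
have cW := @cvg_krawtchouk_mean R u k.
apply: cvg_trans; last exact: (cvgM (@cvg_addn_inv_subn R k.+1)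
  (cvgD (cvgB (cvgM (cvg_cst u) IH1) (cvgM (cvg_cst (k.+1%:R : R)) cW))
        (cvg_cst (k.+1%:R * u ^+ k.+2)))).
apply: near_eq_cvg; near=> N.
have N0 : (N%:R - k.+1%:R : R) != 0 by near: N; exact: near_subn_neq0.
rewrite krawtchouk_meanSS !exprS !fctE /=.
move: (k.+1%:R : R) (N%:R : R) N0 => a b ab0.
by field.
Unshelve. all: by end_near. Qed.

(** The limit of N times the covariance of the signs of two ranks. It follows from
      W_(2s) - W_s^2 = (W_(2s) - u^(2s)) - (W_s - u^s) (W_s + u^s)
    and binom(2s, 2) - 2 binom(s, 2) = s^2. *)
Lemma cvg_krawtchouk_mean_cov (R : realType) (u : R) (s : nat) : (0 < s)%N ->
  N%:R * (krawtchouk_mean u N (2 * s) - krawtchouk_mean u N s ^+ 2)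
    @[N --> \oo] --> - (s%:R ^+ 2) * (1 - u ^+ 2) * u ^+ (2 * s - 2).
Proof.
move=> s0.
have -> : - s%:R ^+ 2 * (1 - u ^+ 2) * u ^+ (2 * s - 2) =
  - 'C(2 * s, 2)%:R * (1 - u ^+ 2) * u ^+ (2 * s - 2) -
  (- 'C(s, 2)%:R * (1 - u ^+ 2) * u ^+ (s - 2)) * (u ^+ s + u ^+ s).
  have -> : 'C(2 * s, 2) = (2 * 'C(s, 2) + s ^ 2)%N.
    have binS2 m : 'C(m.+1, 2) = ('C(m, 2) + m)%N by rewrite binS bin1.
    by elim: s {s0} => // s IH; rewrite mulnS add2n !binS2 IH; lia.
  case: s s0 => // -[|s] _; first by rewrite bin_small // !expr0; ring.
  have -> : (2 * s.+2 - 2 = s + s.+2)%N by lia.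
  rewrite !subSS subn0 natrD natrM natrX exprD !exprS.
  by move: ('C(s.+2, 2)%:R : R) => b; ring.
have cW := @cvg_krawtchouk_mean R u s.
apply: cvg_trans; last exact: (cvgB (@cvg_krawtchouk_mean_defect R u (2 * s))
  (cvgM (@cvg_krawtchouk_mean_defect R u s) (cvgD cW (cvg_cst (u ^+ s))))).
apply: near_eq_cvg; apply: nearW => N.
by rewrite !fctE /= mulnC exprM; ring.
Qed.

(** * Moments under the uniform law on the n-card hands *)

Lemma counting_finType (R : realType) (T : finType) (D : {set T}) :
  (counting [set` D] : \bar R) = #|D|%:R%:E.
Proof.
have -> : [set` D] = [set` [fset x in enum D]%fset].
  by apply/seteqP; split=> x /=; rewrite inE mem_enum.
by rewrite /counting asboolT // set_fsetK card_fseq undup_id ?enum_uniq // -cardE.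
Qed.

Section Draw.
Variables (R : realType) (s r n : nat).
Local Notation hand := (hand s r).

Lemma card_deck : #|{: deck s r}| = (s * r)%N.
Proof. by rewrite card_prod !card_ord. Qed.

Lemma counting_hands :
  (counting (hands s r n) : \bar R) = 'C(s * r, n)%:R%:E.
Proof.
rewrite (_ : hands s r n = [set` [set A : {set deck s r} | #|A| == n]%SET]).
  by rewrite counting_finType card_draws card_deck.
by apply/seteqP; split=> A /=; rewrite inE => /eqP.
Qed.

Lemma draw1 (A : hand) : (n <= s * r)%N ->
  draw R s r n [set A] =
  (if #|(A : {set deck s r})| == n then 'C(s * r, n)%:R^-1 else 0)%:E.
Proof.
move=> nN; rewrite /draw /= /mnormalize /= /mrestr setTI counting_hands /=.
rewrite eqe pnatr_eq0 -leqn0 leqNgt bin_gt0 nN /=.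
case: ifPn => [/eqP|] An.
  rewrite (_ : [set A] `&` _ = [set` [set A]%SET]).
    by rewrite counting_finType cards1 mul1e.
  by apply/seteqP; split=> B /=; rewrite inE; [case=> -> _|move=> /eqP->; split].
rewrite (_ : [set A] `&` _ = set0) ?measure0 ?mul0e //.
by apply/seteqP; split=> // B [->] /= /eqP; rewrite (negPf An).
Qed.

Lemma expectation_sum (P : probability hand R) (f : hand -> R) :
  (forall A, 0 <= f A) ->
  ('E_P[f] = \sum_A (f A)%:E * P [set A])%E.
Proof.
move=> f0; rewrite unlock.
have -> : [set: hand] = \big[setU/set0]_(A <- index_enum hand) [set A].
  apply/seteqP; split=> // A _; rewrite -bigcup_seq.
  by exists A => //=; rewrite mem_index_enum.
rewrite ge0_integral_bigsetU //.
- apply: eq_bigr => A _; rewrite -integral_cst //.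
  by apply: eq_integral => B /set_mem ->.
- exact: index_enum_uniq.
- by apply/trivIsetP => A B _ _ AB; apply/seteqP; split=> // C [->] /eqP; rewrite (negPf AB).
- by move=> A _; rewrite lee_fin.
Qed.

Lemma expectation_draw (f : hand -> R) : (n <= s * r)%N ->
  (forall A, 0 <= f A) -> ('E_(draw R s r n)[f] = (average n f)%:E)%E.
Proof.
move=> nN f0; rewrite expectation_sum // /average card_deck mulr_suml.
rewrite [in RHS]big_mkcond /= -sumEFin; apply: eq_bigr => A _.
by rewrite draw1 // -EFinM; case: ifP; rewrite ?mulr0.
Qed.

Lemma variance_draw (f : hand -> R) : (n <= s * r)%N ->
  (forall A, 0 <= f A) ->
  ('V_(draw R s r n)[f] =
   (average n (fun A => (f A - average n f) ^+ 2))%:E)%E.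
Proof.
move=> nN f0; rewrite /variance unlock (expectation_draw nN f0) /=.
by rewrite expectation_draw // => A; rewrite -expr2 sqr_ge0.
Qed.
End Draw.

(** * Mean and variance of the number of pairs *)

Section Moments.
Variables (R : realType) (s r n : nat) (u : R).
Hypothesis nN : (n <= s * r)%N.
Hypothesis uE : (s * r)%:R * u = (s * r)%:R - 2 * n%:R.
Local Notation w := (krawtchouk_mean u (s * r)).
Local Notation chi := (fun i : 'I_r => character R (rank_class s i)).

(** The identity floor (y / 2) = y / 2 - 1 / 4 + (-1)^y / 4, summed over ranks. *)
Lemma X_character A :
  X R s r A = #|A|%:R / 2 - r%:R / 4 + (\sum_i chi i A) / 4.
Proof.
rewrite /X num_pairsE natr_sum -(sum_card_rank_class A) natr_sum.
have -> : r%:R = \sum_(i < r) 1 :> R by rewrite sumr_const card_ord.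
rewrite !mulr_suml -sumrB -big_split /=; apply: eq_bigr => i _.
rewrite /character -signr_odd; set k := #|_|.
have -> : k%:R = (odd k)%:R + k./2%:R * 2 :> R.
  by rewrite -[in LHS](odd_double_half k) natrD -muln2 natrM.
by case: (odd k); rewrite ?expr1 ?expr0 /=; field.
Qed.

Lemma average_rank_character i : average n (chi i) = w s.
Proof.
by rewrite (average_character (u := u)) card_deck // card_rank_class.
Qed.

Lemma average_rank_characterM i j : i != j ->
  average n (fun A => chi i A * chi j A) = w (2 * s).
Proof.
move=> ij; have dij := disjoint_rank_class s ij.
rewrite (eq_average (g := character R (rank_class s i :|: rank_class s j))).
  rewrite (average_character (u := u)) card_deck // cardsU disjoint_setI0 //.
  by rewrite cards0 subn0 !card_rank_class addnn mul2n.
by move=> A _; rewrite characterU.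
Qed.

Lemma average_X : average n (X R s r) = n%:R / 2 - r%:R / 4 + r%:R * w s / 4.
Proof.
rewrite (eq_average (g := fun A => (n%:R / 2 - r%:R / 4) + 4^-1 * \sum_i chi i A)).
  rewrite averageD averageZ average_sum average_cst ?card_deck //.
  under eq_bigr => i _ do rewrite average_rank_character.
  by rewrite sumr_const card_ord -[w s *+ r]mulr_natl; field.
by move=> A An; rewrite X_character An [_^-1 * _]mulrC.
Qed.

Lemma average_sum_character_sqr :
  average n (fun A => (\sum_i chi i A) ^+ 2) =
  r%:R * (1 + (r%:R - 1) * w (2 * s)).
Proof.
rewrite (eq_average (g := fun A => \sum_i \sum_j chi i A * chi j A)); last first.
  by move=> A _; rewrite expr2 mulr_suml; under eq_bigr do rewrite mulr_sumr.
rewrite average_sum (eq_bigr (fun=> 1 + (r%:R - 1) * w (2 * s))) => [|i _].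
  by rewrite sumr_const card_ord -[LHS]mulr_natl.
rewrite average_sum (bigD1 i) //=; congr (_ + _).
  rewrite (eq_average (g := fun=> 1)) ?average_cst ?card_deck //.
  by move=> A _; rewrite character_sqr.
under eq_bigr => j ji do rewrite average_rank_characterM 1?eq_sym //.
rewrite sumr_const -[LHS]mulr_natl; congr (_ * _).
by rewrite cardC1 card_ord; case: r i => [[]|k] // _; rewrite -natr1 addrK.
Qed.

Lemma average_X_variance :
  average n (fun A => (X R s r A - average n (X R s r)) ^+ 2) =
  r%:R / 16 * (1 + (r%:R - 1) * w (2 * s) - r%:R * w s ^+ 2).
Proof.
rewrite (eq_average (g := fun A => 16^-1 * ((\sum_i chi i A) ^+ 2 +
    ((- 2 * (r%:R * w s)) * (\sum_i chi i A) + (r%:R * w s) ^+ 2)))); last first.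
  by move=> A An; rewrite average_X X_character An; field.
rewrite averageZ averageD averageD averageZ average_cst ?card_deck //.
rewrite average_sum_character_sqr average_sum.
under eq_bigr => i _ do rewrite average_rank_character.
by rewrite sumr_const card_ord -[w s *+ r]mulr_natl; field.
Qed.

End Moments.

(** Along pairs (r, n) with n / (s r) = x the moments are functions of N = s r
    alone, which turns the two-parameter limit into a limit of sequences. *)
Lemma cvg_fixed_ratio (R : realType) (s : nat) (x : R) (g : nat -> R) (l : R)
    (f : nat * nat -> \bar R) : (0 < s)%N -> x < 1 ->
  g N @[N --> \oo] --> l ->
  (forall r n, (0 < r)%N -> (n <= s * r)%N ->
    (s * r)%:R * (1 - 2 * x) = (s * r)%:R - 2 * n%:R ->
    f (r, n) = (g (s * r)%N)%:E) ->
  f p @[p --> fixed_ratio s x] --> l%:E.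
Proof.
move=> s0 x1 gl fg.
have cN : (s * p.1)%N @[p --> fixed_ratio s x] --> \oo.
  apply: cvg_within_filter; apply: (cvg_comp fst (muln s)); first exact: cvg_fst.
  move=> P [M _ MP]; exists M => // k /= Mk; apply: MP => /=.
  by rewrite (leq_trans Mk) // leq_pmull.
have cg : (g (s * p.1)%N)%:E @[p --> fixed_ratio s x] --> l%:E.
  by apply: cvg_EFin; [exact: nearW | exact: (cvg_comp _ _ cN gl)].
apply: cvg_trans cg; apply: near_eq_cvg; rewrite near_withinE.
apply: nearW => -[r n] /= [r2 nx].
have r0 : (0 < r)%N by exact: leq_trans r2.
have N0 : (0 : R) < (s * r)%:R by rewrite ltr0n muln_gt0 s0.
have nE : n%:R = x * (s * r)%:R by rewrite -nx divfK // gt_eqF.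
rewrite fg //; last by rewrite nE; ring.
by rewrite -(ler_nat R) nE ger_pMl // ltW.
Qed.

Theorem theorem5p1 (R : realType) (s : nat) (hs : (2 <= s)%N)
    (x : R) (hx0 : 0 < x) (hx1 : x < 1) :
  (('E_(draw R s p.1 p.2)[X R s p.1] * (p.1%:R^-1)%:E)%E
     @[p --> fixed_ratio s x] -->
   (s%:R / 2 * x - 1 / 4 + (1 - 2 * x) ^+ s / 4)%:E)
  /\
  (('V_(draw R s p.1 p.2)[X R s p.1] * (p.1%:R^-1)%:E)%E
     @[p --> fixed_ratio s x] -->
   (1 / 16 + (s%:R - 1) / 16 * (1 - 2 * x) ^+ (2 * s)
      - s%:R / 16 * (1 - 2 * x) ^+ (2 * s - 2))%:E).
Proof.
set u := 1 - 2 * x.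
have s0 : (0 < s)%N by exact: leq_trans hs.
have X0 r A : 0 <= X R s r A by exact: ler0n.
have sn0 : s%:R != 0 :> R by rewrite pnatr_eq0 -lt0n.
pose w N k := krawtchouk_mean u N k.
have cw k : w N k @[N --> \oo] --> u ^+ k := @cvg_krawtchouk_mean R u k.
split.
- apply: (cvg_fixed_ratio (g := fun N => s%:R / 2 * x - 1 / 4 + w N s / 4)) => //.
    apply: cvgD; first exact: cvg_cst.
    by apply: cvgM; [exact: cw | exact: cvg_cst].
  move=> r n r0 nN uE; rewrite expectation_draw // (average_X nN uE) -EFinM.
  have rn0 : r%:R != 0 :> R by rewrite pnatr_eq0 -lt0n.
  have -> : n%:R = x * (s%:R * r%:R) :> R by move: uE; rewrite natrM; lra.
  by congr (_%:E); rewrite /w; field.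
  (* With N = s r: r (W_(2s) - W_s^2) = (1 / s) N (W_(2s) - W_s^2). *)
- apply: (cvg_fixed_ratio (g := fun N => 16^-1 * (1 - w N (2 * s)%N +
      s%:R^-1 * (N%:R * (w N (2 * s)%N - w N s ^+ 2))))) => //.
    have -> : 1 / 16 + (s%:R - 1) / 16 * u ^+ (2 * s) -
        s%:R / 16 * u ^+ (2 * s - 2) =
      16^-1 * (1 - u ^+ (2 * s) +
        s%:R^-1 * (- (s%:R ^+ 2) * (1 - u ^+ 2) * u ^+ (2 * s - 2))).
      have -> : u ^+ (2 * s) = u ^+ (2 * s - 2) * u ^+ 2.
        by rewrite -exprD subnK // leq_pmulr.
      by field.
    apply: cvgM; first exact: cvg_cst.
    apply: cvgD; first by apply: cvgB; [exact: cvg_cst | exact: cw].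
    by apply: cvgM; [exact: cvg_cst | exact: cvg_krawtchouk_mean_cov].
  move=> r n r0 nN uE; rewrite variance_draw // (average_X_variance nN uE) -EFinM.
  have rn0 : r%:R != 0 :> R by rewrite pnatr_eq0 -lt0n.
  by congr (_%:E); rewrite /w natrM; field; rewrite sn0 rn0.
Qed.
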